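(* Let $A$ be an integral ring. The following are equivalent: 1. $A$ is a Prüfer ring of Krull dimension $\leq 1$. 2. $A$ is a ring with divisors of Krull dimension $\leq 1$.
   Context: Rings are commutative with unit. A ring is integral if every element is zero or regular (the trivial ring is not excluded); $A^*$ is the set of regular elements. For an integral ring, being a Prüfer ring (Prüfer domain) means that every nonzero finitely generated ideal is invertible. An element $g\in A^*$ is a strong gcd of $(a_1,\dots,a_n)$ in $A^*$ if for every $x\in A^*$, $xg$ is a gcd of $(xa_1,\dots,xa_n)$ in $A$. A list $(a_i)$ in $A^*$ is divisorially invertible if there is a list $(b_j)$ in $A^*$ such that $(a_ib_j)_{i,j}$ has a strong gcd. An integral ring is a ring with divisors (PvMD) if every nonempty finite list in $A^*$ (equivalently every nonzero finitely generated ideal) is divisorially invertible. Note that coherence is not assumed. *)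

(* Defs.v *)
From mathcomp Require Import all_boot all_algebra.
From mathcomp Require Import boolp classical_sets.

Set Implicit Arguments.
Unset Strict Implicit.
Unset Printing Implicit Defensive.

Import GRing.Theory.
Local Open Scope classical_set_scope.
Local Open Scope ring_scope.

(* Rings are [comPzRingType]s, the commutative rings with unit in which 1 = 0 *)
(* is allowed. The ideals of [ring_quotient] are boolean predicates over      *)
(* nontrivial rings, so ideals are defined here, as sets.                     *)
Section Defs.
Variable A : comPzRingType.

(* [GRing.lreg a] is the injectivity of multiplication by a; 0 is regular in  *)
(* the trivial ring.                                                          *)
Definition integral_ring : Prop := forall a : A, a = 0 \/ GRing.lreg a.

Definition is_ideal (I : set A) : Prop :=
  [/\ I 0,
      forall x y, I x -> I y -> I (x + y)
    & forall a x, I x -> I (a * x)].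

Definition ideal_gen (X : set A) : set A := smallest is_ideal X.

Definition ideal_mul (I J : set A) : set A :=
  ideal_gen [set x * y | x in I & y in J].

Definition finitely_generated (I : set A) : Prop :=
  exists s : seq A, I = ideal_gen [set` s].

(* For c regular, J is c times the inverse of I as a fractional ideal.        *)
Definition invertible_ideal (I : set A) : Prop :=
  exists (J : set A) (c : A),
    [/\ is_ideal J, GRing.lreg c & ideal_mul I J = ideal_gen [set c]].

(* Only meant for integral rings (Pruefer domains).                           *)
Definition pruefer : Prop :=
  forall I : set A, finitely_generated I -> I <> [set 0] -> invertible_ideal I.

Definition is_prime_ideal (P : set A) : Prop :=
  [/\ is_ideal P, ~ P 1 & forall x y, P (x * y) -> P x \/ P y].

(* There is no chain P_0 < P_1 < ... < P_(n+1) of prime ideals; the trivial   *)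
(* ring has dimension at most n for every n.                                  *)
Definition krull_dim_le (n : nat) : Prop :=
  ~ exists P : 'I_n.+2 -> set A,
      (forall i, is_prime_ideal (P i)) /\
      (forall i j : 'I_n.+2, (i < j)%N -> P i `<` P j).

Definition divides (a b : A) : Prop := exists c, b = c * a.

Definition is_gcd (g : A) (s : seq A) : Prop :=
  {in s, forall a, divides g a} /\
  (forall d, {in s, forall a, divides d a} -> divides d g).

Definition is_strong_gcd (g : A) (s : seq A) : Prop :=
  GRing.lreg g /\
  forall x : A, GRing.lreg x -> is_gcd (x * g) [seq x * a | a <- s].

Definition regular_seq (s : seq A) : Prop := {in s, forall a, GRing.lreg a}.

Definition divisorially_invertible (s : seq A) : Prop :=
  exists2 t : seq A, regular_seq t &
    exists g : A, is_strong_gcd g [seq a * b | a <- s, b <- t].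

Definition with_divisors : Prop :=
  forall s : seq A, s <> [::] -> regular_seq s -> divisorially_invertible s.

End Defs.

(* Main.v *)
Require Import Defs.
From mathcomp Require Import all_boot all_algebra.
From mathcomp Require Import boolp classical_sets.

(** A Pruefer ring has divisors because an invertible ideal is cut out by
    finitely many elements: if [I J = (c)], the finitely many elements of [J]
    needed to write [c] already give products with strong gcd [c].

    Conversely, divide a list with strong gcd [g] by [g]: the quotients [c_k]
    satisfy "[y] divides all [u c_k] implies [y] divides [u]".  It suffices that
    they generate the unit ideal.  Otherwise they lie in a prime [P]; fix
    [c = c_k <> 0].  In dimension at most 1 there is no prime strictly
    between [0] and [P], so the radical of [c A_P] is [P A_P] and every [c_k]
    is nilpotent modulo [K], the contraction of [c A_P] to [A].  Hence some
    [u] outside [K] satisfies [u c_k] in [K] for all [k]; clearing a common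
    denominator, the property of the [c_k] puts [u] in [K], a contradiction. *)

Set Implicit Arguments.
Unset Strict Implicit.
Unset Printing Implicit Defensive.

Import GRing.Theory.
Local Open Scope classical_set_scope.
Local Open Scope ring_scope.

(** * Generated ideals and divisibility *)

Section Ideals.
Variable A : comPzRingType.
Implicit Types I J P Q S X Y : set A.

Lemma ideal_gen_is_ideal X : is_ideal (ideal_gen X).
Proof.
split=> [M [[]] // | x y Xx Xy M MX | a x Xx M MX].
  by have [[_ MD _] _] := MX; apply: MD; [exact: Xx | exact: Xy].
by have [[_ _ MM] _] := MX; apply: MM; exact: Xx.
Qed.

Lemma sub_ideal_gen X : X `<=` ideal_gen X.
Proof. by move=> x Xx M [_]; apply. Qed.

Lemma ideal_gen_min X I : is_ideal I -> X `<=` I -> ideal_gen X `<=` I.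
Proof. by move=> idI XI x; apply. Qed.

Lemma ideal_gen_mono X Y : X `<=` Y -> ideal_gen X `<=` ideal_gen Y.
Proof.
move=> XY; apply: ideal_gen_min; first exact: ideal_gen_is_ideal.
exact: subset_trans XY (@sub_ideal_gen _).
Qed.

Lemma is_ideal_set0 : is_ideal [set (0 : A)].
Proof. by split=> //= [x y -> ->|a x ->]; rewrite ?addr0 ?mulr0. Qed.

(** With [ideal_gen_min], this carries a property of [x * y] from generators [x] to the ideal they
    generate. *)
Lemma colon_is_ideal I y : is_ideal I -> is_ideal [set x | I (x * y)].
Proof.
move=> [I0 ID IM]; split=> [|x z|a x] /=; first by rewrite mul0r.
  by rewrite mulrDl; exact: ID.
by rewrite -mulrA; exact: IM.
Qed.

Lemma dividesD (d x y : A) : divides d x -> divides d y -> divides d (x + y).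
Proof. by move=> [u ->] [v ->]; exists (u + v); rewrite mulrDl. Qed.

Lemma divides_mull (d a x : A) : divides d x -> divides d (a * x).
Proof. by move=> [u ->]; exists (a * u); rewrite mulrA. Qed.

Lemma multiples_is_ideal (d : A) : is_ideal (divides d).
Proof.
by split; [exists 0; rewrite mul0r | exact: dividesD | exact: divides_mull].
Qed.

Lemma ideal_gen_set1 (c : A) : ideal_gen [set c] = divides c.
Proof.
apply/seteqP; split.
  apply: ideal_gen_min; first exact: multiples_is_ideal.
  by move=> _ ->; exists 1; rewrite mul1r.
have [_ _ cM] := ideal_gen_is_ideal [set c].
by move=> _ [a ->]; apply: cM; exact: sub_ideal_gen.
Qed.

(** * Prime ideals missing a multiplicative set *)

(** Krull's argument: an ideal maximal among those containing [I] and missing [S] is prime. *)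
Lemma prime_avoiding (S I : set A) :
    S 1 -> (forall x y, S x -> S y -> S (x * y)) ->
    is_ideal I -> (forall x, I x -> ~ S x) ->
  exists P, [/\ is_prime_ideal P, I `<=` P & forall x, P x -> ~ S x].
Proof.
move=> S1 SM idI IS.
(* Phrasing the condition on [I `|` X] makes the empty chain harmless. *)
pose adm X := is_ideal (I `|` X) /\ forall x, (I `|` X) x -> ~ S x.
have [|X [[idX XS] Xmax]] := @Zorn_bigcup A adm.
  move=> F Fadm Ftot; split; last first.
    move=> x [/IS //|[X FX Xx]].
    by have [_] := Fadm _ FX; apply; right.
  have [I0 ID IM] := idI; split; first by left.
  - move=> x y [Ix|[X FX Xx]] [Iy|[Y FY Yy]]; first by left; exact: ID.
    + have [[_ YD _] _] := Fadm _ FY.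
      have [?|?] := YD _ _ (or_introl Ix) (or_intror Yy); first by left.
      by right; exists Y.
    + have [[_ XD _] _] := Fadm _ FX.
      have [?|?] := XD _ _ (or_intror Xx) (or_introl Iy); first by left.
      by right; exists X.
    + wlog XY : x y X Y FX Xx FY Yy / X `<=` Y.
        have [XY|YX] := Ftot X Y FX FY => h; first exact: (h x y X Y).
        by rewrite addrC; exact: (h y x Y X).
      have [[_ YD _] _] := Fadm _ FY.
      have [?|?] := YD _ _ (or_intror (XY _ Xx)) (or_intror Yy); first by left.
      by right; exists Y.
  - move=> a x [Ix|[X FX Xx]]; first by left; exact: IM.
    have [[_ _ XM] _] := Fadm _ FX.
    by have [?|?] := XM a _ (or_intror Xx); [left | right; exists X].
have [J0 JD JM] := idX; set J := I `|` X in idX XS J0 JD JM.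
(* By maximality, the ideal generated by [J] and [x] meets [S]. *)
have meet x : ~ J x -> exists a j, J j /\ S (j + a * x).
  move=> Jx; apply: contrapT => nS.
  pose B : set A := [set z | exists a j, J j /\ z = j + a * x].
  have JB : J `<=` B by move=> j Jj; exists 0, j; rewrite mul0r addr0.
  have IB : I `|` B = B by apply/setUidPr => z Iz; apply: JB; left.
  apply: (Xmax B).
    rewrite properEneq; split; last by move=> z Xz; apply: JB; right.
    apply/eqP => XB; apply: Jx; right; rewrite XB.
    by exists 1, 0; rewrite mul1r add0r.
  rewrite /adm IB; split; last first.
    by move=> _ [a [j [Jj ->]]] Sz; apply: nS; exists a, j.
  split; first exact: JB.
    move=> _ _ [a [j [Jj ->]]] [b [k [Jk ->]]]; exists (a + b), (j + k).
    by split; [exact: JD | rewrite mulrDl addrACA].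
  move=> r _ [a [j [Jj ->]]]; exists (r * a), (r * j).
  by split; [exact: JM | rewrite mulrDr mulrA].
exists J; split=> //; last by move=> x Ix; left.
split=> // [J1|x y Jxy]; first exact: XS S1.
apply: contrapT => /not_orP[/meet[a [j [Jj Sj]]] /meet[b [k [Jk Sk]]]].
(* [(j + a * x) * (k + b * y)] is in [S] and, since [x * y] is in [J], also in [J]. *)
apply: (XS _ _ (SM _ _ Sj Sk)).
rewrite mulrDl; apply: (JD); first by rewrite mulrC; apply: JM.
rewrite mulrDr; apply: (JD); first exact: JM.
by rewrite mulrACA; exact: JM.
Qed.

Lemma prime_ideal_ex I :
  is_ideal I -> ~ I 1 -> exists2 P, is_prime_ideal P & I `<=` P.
Proof.
move=> idI I1; have [||//||P [? ? _]] := @prime_avoiding [set 1] I.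
- by [].
- by move=> _ _ -> ->; rewrite /= mul1r.
- by move=> x Ix x1; apply: I1; rewrite -x1.
- by exists P.
Qed.

Lemma regular0_trivial (x : A) : GRing.lreg (0 : A) -> x = 0.
Proof. by apply; rewrite !mul0r. Qed.

(** * Integral rings of dimension at most 1 *)

Hypothesis hA : integral_ring A.

Lemma regular_neq0 (x : A) : x <> 0 -> GRing.lreg x.
Proof. by case: (hA x). Qed.

Lemma set0_prime : 1 <> 0 :> A -> is_prime_ideal [set (0 : A)].
Proof.
move=> n10; split=> [||x y /= xy0]; [exact: is_ideal_set0 | exact: n10 |].
by have [|xreg] := hA x; [left | right; apply: xreg; rewrite xy0 mulr0].
Qed.

Hypothesis dimA : krull_dim_le A 1.

(** Otherwise [c] separates [0] from [Q] and [d] separates [Q] from [P], a chain of three primes. *)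
Lemma no_intermediate_prime P Q (c d : A) :
    is_prime_ideal P -> is_prime_ideal Q -> Q `<=` P ->
  c <> 0 -> Q c -> P d -> Q d.
Proof.
move=> primeP primeQ QP c0 Qc Pd; apply: contrapT => Qd; apply: dimA.
have n10 : 1 <> 0 :> A by move=> e; apply: c0; rewrite -[c]mul1r e mul0r.
have [[Q0 _ _] _ _] := primeQ; have [[P0 _ _] _ _] := primeP.
exists (fun i : 'I_3 => if i == 0%N :> nat then [set (0 : A)]
                        else if i == 1%N :> nat then Q else P).
split=> [i|]; first by do 2?case: ifP => _ //; exact: set0_prime.
have ltQ : [set (0 : A)] `<` Q.
  by split=> [|/(_ c Qc)//] _ ->.
have ltP : Q `<` P by split=> // /(_ d Pd).
have lt0P : [set (0 : A)] `<` P by split=> [_ ->|/(_ c (QP _ Qc))].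
by case=> [[|[|[|i]]] hi] [[|[|[|j]]] hj].
Qed.

Lemma power_in_local_ideal P (c d : A) :
    is_prime_ideal P -> c <> 0 -> P d ->
  exists n s, ~ P s /\ divides c (s * d ^+ n).
Proof.
move=> primeP c0 Pd; apply: contrapT => nK.
have [_ P1 Pprime] := primeP.
(* [S] contains [d] and everything outside [P], so a prime missing it lies in [P] and omits [d]. *)
pose S : set A := [set z | exists n s, ~ P s /\ z = s * d ^+ n].
have [||||Q [primeQ cQ QS]] := @prime_avoiding S (divides c).
- by exists 0%N, 1; rewrite expr0 mulr1.
- move=> _ _ [n [s [Ps ->]]] [m [r [Pr ->]]]; exists (n + m)%N, (s * r).
  by split; [move=> /Pprime[] | rewrite exprD mulrACA].
- exact: multiples_is_ideal.
- by move=> x cx [n [s [Ps xE]]]; apply: nK; exists n, s; rewrite -xE.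
have Qc : Q c by apply: cQ; exists 1; rewrite mul1r.
have QP : Q `<=` P.
  move=> x Qx; apply: contrapT => Px; apply: (QS _ Qx).
  by exists 0%N, x; rewrite expr0 mulr1.
apply: (QS d); first exact: no_intermediate_prime QP c0 Qc Pd.
by exists 1%N, 1; rewrite expr1 mul1r.
Qed.

End Ideals.

(** * Contraction of a principal ideal of the localization at [P] *)

Section Contraction.
Variables (A : comPzRingType) (P : set A) (c : A).
Hypothesis primeP : is_prime_ideal P.

(** The contraction of [c A_P] to [A], without building [A_P]: [s] is a denominator. *)
Definition local_multiples : set A :=
  [set u | exists2 s, ~ P s & divides c (s * u)].

Lemma local_multiples_mull (a u : A) :
  local_multiples u -> local_multiples (a * u).
Proof. by move=> [s Ps cs]; exists s; rewrite // mulrCA; exact: divides_mull. Qed.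

(** The product of the denominators serves, since [P] is prime. *)
Lemma local_multiples_common (u : A) (l : seq A) :
    {in l, forall x, local_multiples (u * x)} ->
  exists2 s, ~ P s & {in l, forall x, divides c (s * (u * x))}.
Proof.
have [_ P1 Pprime] := primeP.
elim: l => [|x l IHl] Kl; first by exists 1.
have [|s Ps sl] := IHl; first by move=> y yl; apply: Kl; rewrite inE yl orbT.
have [|r Pr rx] := Kl x; first by rewrite inE eqxx.
exists (s * r) => [/Pprime[]//|y]; rewrite inE => /predU1P[->|/sl csy].
  by rewrite -mulrA; exact: divides_mull.
by rewrite mulrAC mulrC; exact: divides_mull.
Qed.

End Contraction.

(** * A criterion for generating the unit ideal *)

(** For each new [x], [u] is replaced by the last [u * x ^+ n] outside [K]; what held for the
    earlier elements survives multiplication. *)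
Lemma socle_element (A : comPzRingType) (K : set A) (l : seq A) :
    (forall a u, K u -> K (a * u)) -> ~ K 1 ->
    {in l, forall x, exists n, K (x ^+ n)} ->
  exists2 u, ~ K u & {in l, forall x, K (u * x)}.
Proof.
move=> KM K1; elim: l => [|x l IHl] Kl; first by exists 1.
have [|u Ku ul] := IHl; first by move=> y yl; apply: Kl; rewrite inE yl orbT.
have [|n Kxn] := Kl x; first by rewrite inE eqxx.
have {Kxn} : K (u * x ^+ n) by exact: KM.
elim: n => [|n IHn]; first by rewrite expr0 mulr1.
have [/IHn //|Kuxn] := pselect (K (u * x ^+ n)).
rewrite exprSr mulrA => Kx; exists (u * x ^+ n) => // y.
by rewrite inE => /predU1P[->//|/ul Kuy]; rewrite mulrAC mulrC; exact: KM.
Qed.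

Lemma ideal_gen_unit_of_dim1 (A : comPzRingType) (l : seq A) :
    integral_ring A -> krull_dim_le A 1 ->
    (forall u y, {in l, forall x, divides y (u * x)} -> divides y u) ->
  ideal_gen [set` l] 1.
Proof.
move=> hA dimA glueA; apply: contrapT => I1.
have [P primeP IP] := prime_ideal_ex (ideal_gen_is_ideal _) I1.
have Pl x : x \in l -> P x by move=> xl; apply: IP; exact: sub_ideal_gen.
have [[P0 _ PM] P1 _] := primeP.
(* If [l] had only zeros, 0 would divide them all, hence 1 by [glueA]. *)
have [c cl c0] : exists2 c, c \in l & c <> 0.
  apply: contrapT => nc; apply: P1.
  have [|a ->] := glueA 1 0; last by rewrite mulr0.
  move=> x xl; have -> : x = 0.
    by apply: contrapT => x0; apply: nc; exists x.
  by exists 0; rewrite mulr0 mul0r.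
pose K := local_multiples P c.
(* A denominator that is a multiple of [c] would lie in [P]. *)
have K1 : ~ K 1.
  by move=> [s Ps []]; rewrite mulr1 => a sE; apply: Ps; rewrite sE; exact/PM/Pl.
have [|x xl|u Ku ul] := @socle_element A K l _ K1.
- by move=> a u; exact: local_multiples_mull.
- have [n [s [Ps cs]]] :=
    power_in_local_ideal hA dimA primeP c0 (Pl _ xl).
  by exists n, s.
have [s Ps sl] := local_multiples_common primeP ul.
(* [c] divides [s * u * x] for every [x] in [l], hence [s * u], which puts [u] in [K]. *)
by apply: Ku; exists s => //; apply: glueA => x /sl; rewrite mulrA.
Qed.

(** * From strong gcds to invertible ideals *)

Lemma factor_seq (A : comPzRingType) (g : A) (s : seq A) :
  {in s, forall a, divides g a} -> exists l, s = [seq x * g | x <- l].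
Proof.
elim: s => [|a s IHs] gs; first by exists [::].
have [|l ->] := IHs; first by move=> b bs; apply: gs; rewrite inE bs orbT.
have [|x ->] := gs a; first by rewrite inE eqxx.
by exists (x :: l).
Qed.

Lemma strong_gcd_in_ideal_gen (A : comPzRingType) (g : A) (s : seq A) :
    integral_ring A -> krull_dim_le A 1 -> is_strong_gcd g s ->
  ideal_gen [set` s] g.
Proof.
move=> hA dimA [greg gcdg].
have [/factor_seq[l sE] _] : is_gcd g s.
  by have := gcdg 1 (@lreg1 A); rewrite mul1r (eq_map (@mul1r A)) map_id.
have: ideal_gen [set` l] 1.
  apply: ideal_gen_unit_of_dim1 => // u y yl.
  (* For [u] regular, [y * g] divides every [u * (x * g)], hence their gcd [u * g], and [g]
     cancels. *)
  have [->|/gcdg[_ gcdu]] := hA u; first by exists 0; rewrite mul0r.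
  have [|a aE] := gcdu (y * g).
    move=> z; rewrite sE -map_comp => /mapP[x /yl[b xE] ->] /=.
    by exists b; rewrite mulrA xE mulrA.
  by exists a; apply: greg; rewrite mulrC aE mulrA mulrC.
rewrite -[X in _ -> _ X]mul1r.
apply: (ideal_gen_min (colon_is_ideal g (ideal_gen_is_ideal _))) => x /= xl.
by apply: sub_ideal_gen; rewrite sE; exact: map_f.
Qed.

(** The list [t] that completes [s] generates the inverse up to [g]: the strong gcd [g] divides all
    products and lies in the ideal they generate. *)
Lemma pruefer_of_with_divisors (A : comPzRingType) :
  integral_ring A -> krull_dim_le A 1 -> with_divisors A -> pruefer A.
Proof.
move=> hA dimA divA _ [s0 ->] I0.
(* Zeros are dropped, without changing the ideal, because [divA] takes lists of regular elements. *)
pose s := [seq x <- s0 | x != 0].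
have sE : ideal_gen [set` s0] = ideal_gen [set` s].
  have [s_0 _ _] := ideal_gen_is_ideal [set` s].
  apply/seteqP; split; last first.
    by apply: ideal_gen_mono => x /=; rewrite mem_filter => /andP[].
  apply: ideal_gen_min => [|x /= xs]; first exact: ideal_gen_is_ideal.
  have [->//|x0] := eqVneq x 0.
  by apply: sub_ideal_gen; rewrite /= mem_filter x0.
rewrite sE in I0 *.
have [||t treg [g gcdg]] := divA s.
- move=> s_nil; apply: I0; apply/seteqP; split.
    by apply: ideal_gen_min (@is_ideal_set0 A) _ => x /=; rewrite s_nil.
  by move=> _ ->; have [] := ideal_gen_is_ideal [set` s].
- by move=> x; rewrite mem_filter => /andP[/eqP x0 _]; exact: regular_neq0.
have gst := strong_gcd_in_ideal_gen hA dimA gcdg; have [greg gcdx] := gcdg.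
exists (ideal_gen [set` t]), g; split=> //; first exact: ideal_gen_is_ideal.
rewrite ideal_gen_set1; apply/seteqP; split; last first.
  have [_ _ IJM] := ideal_gen_is_ideal
    [set x * y | x in ideal_gen [set` s] & y in ideal_gen [set` t]].
  move=> _ [a ->]; apply: IJM; apply: ideal_gen_mono gst => z /=.
  move=> /allpairsP[[x y] [/= xs yt ->]].
  by exists x; [exact: sub_ideal_gen | exists y; [exact: sub_ideal_gen |]].
apply: ideal_gen_min; first exact: multiples_is_ideal.
have gI := multiples_is_ideal g.
move=> _ [x sx [y ty <-]].
(* Divisibility by [g] extends from the generators one factor at a time. *)
apply: (ideal_gen_min (colon_is_ideal y gI)) sx => {}x /= xs.
rewrite mulrC.
apply: (ideal_gen_min (colon_is_ideal x gI)) ty => {}y /= yt.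
have [+ _] := gcdx 1 (@lreg1 A); rewrite (eq_map (@mul1r A)) map_id mul1r.
by apply; rewrite mulrC; exact: allpairs_f.
Qed.

(** * From invertible ideals to strong gcds *)

Lemma ideal_mul_finite (A : comPzRingType) (s : seq A) (J : set A) (c : A) :
    integral_ring A -> ideal_mul (ideal_gen [set` s]) J c ->
  exists t, [/\ regular_seq t, {in t, forall y, J y} &
    ideal_gen [set` [seq a * b | a <- s, b <- t]] c].
Proof.
move=> hA.
set F := fun t => ideal_gen [set` [seq a * b | a <- s, b <- t]].
have idF t : is_ideal (F t) by exact: ideal_gen_is_ideal.
have Fmono t t' : {subset t <= t'} -> F t `<=` F t'.
  move=> tt'; apply: ideal_gen_mono => _ /= /allpairsP[[a b] [/= sa tb ->]].
  by apply: allpairs_f => //; exact: tt'.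
(* The elements reached by some finite [t] form an ideal: for sums, lists are concatenated. *)
apply: (@ideal_gen_min _ _ [set z | exists t,
  [/\ regular_seq t, {in t, forall y, J y} & F t z]]); first split.
- by exists [::]; split=> //; have [] := idF [::].
- move=> x y [t [treg tJ tx]] [t' [treg' tJ' ty]]; exists (t ++ t').
  split=> [z|z|]; try by rewrite mem_cat => /orP[]; auto.
  have [_ FD _] := idF (t ++ t').
  apply: FD; [apply: Fmono tx | apply: Fmono ty] => z zt;
    by rewrite mem_cat zt ?orbT.
- by move=> a x [t [? ? tx]]; exists t; split=> //; have [_ _] := idF t; apply.
move=> _ [x sx [y Jy <-]].
(* A zero [y] is left out, which keeps [t] regular. *)
have [->|yreg] := hA y.
  by exists [::]; split=> //; rewrite mulr0; have [] := idF [::].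
exists [:: y]; split; try by move=> z; rewrite inE => /eqP->.
apply: (ideal_gen_min (colon_is_ideal y (idF _))) sx => z /= sz.
by apply: sub_ideal_gen; apply: allpairs_f; rewrite ?inE.
Qed.

Lemma with_divisors_of_pruefer (A : comPzRingType) :
  integral_ring A -> pruefer A -> with_divisors A.
Proof.
move=> hA prA s s_nil sreg.
(* In the trivial ring 0 is regular and [s] generates the zero ideal, about which [prA] says
   nothing. *)
have [A0|A1] := pselect (GRing.lreg (0 : A)).
  have eqA (x y : A) : x = y by rewrite (regular0_trivial x A0) (regular0_trivial y A0).
  exists [::] => //; exists 0; split=> // x _.
  by split=> [z _ | d _]; exists 0; exact: eqA.
have [||J [c [_ creg IJ]]] := prA (ideal_gen [set` s]).
- by exists s.
- case: s s_nil sreg => // a s _ sreg s0; apply: A1.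
  have : ideal_gen [set` a :: s] a by apply: sub_ideal_gen; rewrite /= inE eqxx.
  by rewrite s0 /= => <-; apply: sreg; rewrite inE eqxx.
have cIJ : ideal_mul (ideal_gen [set` s]) J c.
  by rewrite IJ; exact: sub_ideal_gen.
have [t [treg tJ tc]] := ideal_mul_finite hA cIJ.
(* [c] divides each product, as these lie in [(c)]; being a combination of them, it gives [x * c]
   every common divisor of the products scaled by [x]. *)
exists t => //; exists c; split=> // x _; split=> [_ /mapP[z + ->]|d dst].
  move=> /allpairsP[[a b] [/= sa tb ->]].
  suff [r ->] : divides c (a * b) by exists r; rewrite mulrCA.
  rewrite -ideal_gen_set1 -IJ; apply: sub_ideal_gen.
  by exists a; [exact: sub_ideal_gen | exists b; [exact: tJ |]].
rewrite mulrC.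
apply: (ideal_gen_min (colon_is_ideal x (multiples_is_ideal d))) tc => z /= zst.
by rewrite mulrC; apply: dst; exact: map_f.
Qed.

Theorem mainTheorem6 (A : comPzRingType) (hA : integral_ring A) :
  (pruefer A /\ krull_dim_le A 1) <-> (with_divisors A /\ krull_dim_le A 1).
Proof.
split=> [[prA dimA]|[divA dimA]]; split=> //.
  exact: with_divisors_of_pruefer.
exact: pruefer_of_with_divisors.
Qed.
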